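(* Let $n\ge 1$, $m\geq 1$ and $k\geq 0$ be integers with $km \leq n$. The number of parking functions of length $n$ with exactly $k$ $m$-cycles is $$\sum_{\substack{\ell\ge 0\\ (k+\ell)m \leq n}} (-1)^{\ell}\, \frac{\left((m-1)!\right)^{k+\ell}}{k!\,\ell!} \binom{n+1}{m, \dots, m,\, n-(k+\ell)m+1} (n+1)^{n-(k+\ell)m-1},$$ where in the multinomial coefficient the entry $m$ is repeated $k+\ell$ times.
   Context: A parking function of length $n$ is a sequence $\pi=(\pi_1,\dots,\pi_n)$ of positive integers such that, if $\lambda_1\le\cdots\le\lambda_n$ is the weakly increasing rearrangement of $\pi_1,\dots,\pi_n$, then $\lambda_i\le i$ for all $1\le i\le n$. For $m\ge 1$, distinct indices $(i_1,\dots,i_m)$ in $\{1,\dots,n\}$ form an $m$-cycle of $\pi$ if $\pi_{i_1}=i_2,\ \pi_{i_2}=i_3,\dots,\pi_{i_{m-1}}=i_m,\ \pi_{i_m}=i_1$; tuples that differ by a cyclic rotation are regarded as the same $m$-cycle. For $m=1$ an $m$-cycle is a fixed point, i.e. an index $i$ with $\pi_i=i$. The multinomial coefficient with $k+\ell$ entries equal to $m$ is $\binom{n+1}{m,\dots,m,\,n-(k+\ell)m+1}=\frac{(n+1)!}{(m!)^{k+\ell}\,(n-(k+\ell)m+1)!}$. *)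

(* Defs.v *)
From mathcomp Require Import all_boot all_order all_algebra.

Set Implicit Arguments.
Unset Strict Implicit.
Unset Printing Implicit Defensive.

Import GRing.Theory Num.Theory.

(* [nth 0 (sort leq s) i] is lambda_(i+1). *)
Definition is_parking (s : seq nat) : bool :=
  all (leq 1) s &&
  [forall i : 'I_(size s), nth 0 (sort leq s) i <= i.+1].

(* Parking functions of length n take their values in {1, ..., n}, so they are
   represented by functions p : 'I_n -> 'I_n, with indices and values both
   shifted down by one: [p i = j] stands for pi_(i+1) = j+1. The lemmas
   [word_inj] and [parking_word] show that no sequence is lost or counted
   twice. *)
Definition word n (p : {ffun 'I_n -> 'I_n}) : seq nat :=
  [seq (p i).+1 | i <- enum 'I_n].

Definition parking_function n (p : {ffun 'I_n -> 'I_n}) : bool :=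
  is_parking (word p).

Definition cycle_tuples m n (p : {ffun 'I_n -> 'I_n}) : {set m.-tuple 'I_n} :=
  [set t : m.-tuple 'I_n | uniq t & fcycle p t].

Definition rotations m n (t : m.-tuple 'I_n) : {set m.-tuple 'I_n} :=
  [set [tuple of rot j t] | j : 'I_m].

(* An m-cycle is a class of tuples up to cyclic rotation. *)
Definition mcycles m n (p : {ffun 'I_n -> 'I_n}) : {set {set m.-tuple 'I_n}} :=
  [set rotations t | t in cycle_tuples m p].

Definition parking_with_mcycles n m k : {set {ffun 'I_n -> 'I_n}} :=
  [set p | parking_function p & #|mcycles m p| == k].

(* The multinomial coefficient of n+1 over j entries m and one entry
   n - j*m + 1; meaningful for j * m <= n. *)
Definition multinom n m j : rat :=
  ((n.+1)`!%:R / ((m`! ^ j)%:R * ((n - j * m).+1)`!%:R))%R.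

Lemma size_word n (p : {ffun 'I_n -> 'I_n}) : size (word p) = n.
Proof. by rewrite size_map size_enum_ord. Qed.

Lemma word_inj n : injective (@word n).
Proof.
move=> p q /eq_in_map e; apply/ffunP => i; apply: val_inj.
by have [] := e i (mem_enum _ i).
Qed.

Lemma parking_word n (s : seq nat) : size s = n -> is_parking s ->
  exists p : {ffun 'I_n -> 'I_n}, word p = s.
Proof.
move=> sn /andP[/allP s_gt0 /forallP s_le].
have s_range i : i < n -> 0 < nth 0 s i <= n.
  move=> lt_in; have s_i : nth 0 s i \in s by rewrite mem_nth ?sn.
  rewrite s_gt0 //=; have : nth 0 s i \in sort leq s by rewrite mem_sort.
  case/(nthP 0) => j; rewrite size_sort => lt_js <-.
  by apply: leq_trans (s_le (Ordinal lt_js)) _; rewrite /= -sn.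
case: n sn s_range => [|n] sn s_range.
  by exists [ffun i => i]; rewrite (size0nil sn); apply: size0nil; rewrite size_word.
exists [ffun i : 'I_n.+1 => inord (nth 0 s i).-1].
apply: (@eq_from_nth _ 0) => [|i]; rewrite size_word // => lt_in.
have /andP[gt0 le_n] := s_range i lt_in.
rewrite (nth_map ord0) ?size_enum_ord // ffunE nth_enum_ord // inordK prednK //.
Qed.

(* Main.v *)
Require Import Defs.
From mathcomp Require Import all_boot all_order all_algebra.
From mathcomp Require Import fingroup perm zify ring.

(** Inclusion-exclusion reduces the count to the moments
    E_j = sum over parking p of 'C(N p, j), where N p is the number of m-cycles.
    Choosing a first point on each of j ordered cycles, N p ^_ j * m ^ j is the
    number of injective g : 'I_j * 'I_m -> 'I_n intertwining p with the shift sg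
    (a, b) |-> (a, b + 1).  Parking is invariant under permuting positions, so
    for each g the positions can be moved so that g occupies fixed positions w;
    the condition becomes p o w = g o sg, which determines g from p.  Hence
    j! * m ^ j * E_j is the number of parking functions injective on j * m given
    positions.  These are counted by Pollak's circle argument: injectivity is
    rotation invariant and, among the n + 1 rotations of any function
    'I_n -> Z/(n+1), exactly one is parking. *)

Set Implicit Arguments.
Unset Strict Implicit.
Unset Printing Implicit Defensive.

Import GRing.Theory Num.Theory.

(** * Parking in terms of the number of small values *)

Lemma card_set_sum (T : finType) (P : pred T) : #|[set x | P x]| = \sum_x P x.
Proof. by rewrite -sum1dep_card big_mkcond. Qed.

Lemma sorted_nth_leq (s : seq nat) i b : sorted leq s -> i < size s ->
  (nth 0 s i <= b) = (i < count (fun v => v <= b) s).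
Proof.
elim: s i => [|x s IH] i //= sx; have sS := path_sorted sx.
have lex : all (leq x) s by rewrite (order_path_min leq_trans).
case: i => [|i] /= lt_i; last first.
  rewrite IH //; case: (leqP x b) => [//|ltbx].
  rewrite [in RHS](@eq_in_count _ _ pred0); last first.
    by move=> y /(allP lex) /=; lia.
  rewrite (@eq_in_count _ _ pred0) ?count_pred0 //.
  by move=> y /(allP lex) /=; lia.
case: (leqP x b) => [//|ltbx].
rewrite (@eq_in_count _ _ pred0) ?count_pred0 //.
by move=> y /(allP lex) /=; lia.
Qed.

(** In a sorted list, entry [i] is at most [b] iff more than [i] entries are at most [b]. Values in
    [word p] are shifted up by one, so the bound [i.+1] there becomes [i] here. Sorting disappears,
    which makes invariance under permuting positions visible. *)
Lemma parking_functionE n (p : {ffun 'I_n -> 'I_n}) :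
  parking_function p = [forall i : 'I_n, i < #|[set x | p x <= i]|].
Proof.
have count_word b :
    count (fun v => v <= b.+1) (word p) = #|[set x | p x <= b]|.
  by rewrite count_map cardE size_filter -enumT; apply: eq_count => x; rewrite /= inE.
have sorted_word : sorted leq (sort leq (word p)) by apply: sort_sorted leq_total _.
rewrite /parking_function /is_parking.
have -> : all (leq 1) (word p) by apply/allP => x /mapP[i _ ->].
apply/forallP/forallP => /= h i.
  have lt_i : i < size (word p) by rewrite size_word.
  have := h (Ordinal lt_i); rewrite /= sorted_nth_leq ?size_sort //.
  by rewrite count_sort count_word.
rewrite sorted_nth_leq ?size_sort ?ltn_ord //.
rewrite count_sort count_word.
have lt_i : i < n by have := ltn_ord i; rewrite [X in _ < X]size_word.
exact: h (Ordinal lt_i).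
Qed.

(** * Pollak's circle argument *)

Definition circle_parking n (r : {ffun 'I_n -> 'I_n.+1}) : bool :=
  [forall i : 'I_n, i < #|[set x | r x <= i]|].

Definition turn n (t : 'I_n.+1) (r : {ffun 'I_n -> 'I_n.+1}) :
  {ffun 'I_n -> 'I_n.+1} := [ffun x => (r x - t)%R].

(* Equals n + #{x | r x < u} - u. As in the cycle lemma, the rotation that parks
   starts at the first minimum of this function. *)
Definition excess n (r : {ffun 'I_n -> 'I_n.+1}) (u : 'I_n.+1) : nat :=
  #|[set x | r x < u]| + (n - u).

Lemma val_subZp n (a b : 'I_n.+1) :
  val (a - b)%R = if a < b then a + n.+1 - b else a - b.
Proof.
have lea := ltn_ord a; have leb := ltn_ord b.
rewrite /= modnDmr; case: ltnP => ltab; first by rewrite modn_small; lia.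
by rewrite addnBA 1?ltnW // addnC -addnBA // modnDl modn_small; lia.
Qed.

(** [turn t r x <= i] says that [r x] lies in the cyclic interval of [i.+1] points starting at [t].
    With [u] its end, t + i + 1 modulo n + 1, the parking condition at [i] compares [excess] at [t]
    and at [u]. If the interval passes n ([lo]), wrapping makes the inequality strict; otherwise
    ([hi]) it is weak. *)
Lemma circle_parking_turn n (r : {ffun 'I_n -> 'I_n.+1}) (t : 'I_n.+1) :
  reflect (forall u : 'I_n.+1,
             if u < t then excess r t < excess r u else excess r t <= excess r u)
    (circle_parking (turn t r)).
Proof.
have hi (i : nat) (u : 'I_n.+1) : t < u -> i.+1 = u - t ->
    #|[set x | turn t r x <= i]| + #|[set x | r x < t]| = #|[set x | r x < u]|.
  move=> ltu ei; rewrite !card_set_sum -big_split; apply: eq_bigr => x _ /=.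
  rewrite ffunE val_subZp; have := ltn_ord u; have := ltn_ord (r x).
  by case: (ltnP (r x) t); case: (ltnP (r x) u); case: (leqP _ i) => /=; lia.
have lo (i : nat) (u : 'I_n.+1) : u < t -> i = u + n - t ->
    #|[set x | turn t r x <= i]| + #|[set x | r x < t]|
    = n + #|[set x | r x < u]|.
  move=> ltu ei; rewrite !card_set_sum.
  have -> : n + \sum_(x < n) (r x < u) = \sum_(x < n) 1 + \sum_(x < n) (r x < u).
    by rewrite sum1_card card_ord.
  rewrite -!big_split; apply: eq_bigr => x _ /=.
  rewrite ffunE val_subZp; have := ltn_ord t; have := ltn_ord (r x).
  by case: (ltnP (r x) t); case: (ltnP (r x) u); case: (leqP _ i) => /=; lia.
apply: (iffP forallP) => /= h => [u | i]; rewrite /excess.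
  have lun := ltn_ord u; have ltn := ltn_ord t.
  case: (ltngtP u t) => [ltut | ltut | /val_inj->]; last by [].
    have lt_i : u + n - t < n by lia.
    move: (h (Ordinal lt_i)) (lo _ u ltut erefl) => /=; lia.
  have lt_i : (u - t).-1 < n by lia.
  move: (h (Ordinal lt_i)) (hi (u - t).-1 u ltut) => /=; lia.
have lin := ltn_ord i; have ltn := ltn_ord t.
have [le_n | gt_n] := leqP (t + i.+1) n.
  have lt_u : t + i.+1 < n.+1 by lia.
  move: (h (Ordinal lt_u)) (hi i (Ordinal lt_u)); rewrite /excess /=.
  by case: ltnP; lia.
have lt_u : t + i - n < n.+1 by lia.
move: (h (Ordinal lt_u)) (lo i (Ordinal lt_u)); rewrite /excess /=.
by case: ltnP; lia.
Qed.

Lemma sum_circle_parking_turn n (r : {ffun 'I_n -> 'I_n.+1}) :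
  \sum_t circle_parking (turn t r) = 1.
Proof.
(* Since u < n + 1, this orders by [excess] first and by position second, so its minimum is the
   first minimum of [excess]. *)
pose key u := excess r u * n.+1 + u.
case: (arg_minnP key (isT : xpredT ord0)) => t _ tmin.
have good_t : circle_parking (turn t r).
  apply/circle_parking_turn => u; have := tmin u isT; rewrite /key.
  have := ltn_ord u; have := ltn_ord t.
  by case: ifP; nia.
rewrite (bigD1 t) //= good_t big1 // => u neq_ut.
apply/eqP; rewrite eqb0; apply/negP => /circle_parking_turn/(_ t).
have /circle_parking_turn/(_ u) := good_t.
have : val u != val t by [].
by case: (ltngtP u t); lia.
Qed.

(** The restriction of [r] along [w] is an injective function, and the values off the image of [w]
    are free. *)
Lemma card_ffun_inj_on (I A B : finType) (w : I -> A) : injective w ->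
  #|[set r : {ffun A -> B} | injectiveb (r \o w)]|
  = #|B| ^_ #|I| * #|B| ^ (#|A| - #|I|).
Proof.
move=> w_inj; rewrite -card_inj_ffuns -sum_nat_const -sum1_card.
pose res (r : {ffun A -> B}) := [ffun i => r (w i)].
rewrite (partition_big res (mem [set h : {ffun I -> B} | injectiveb h])) /=; last first.
  move=> r; rewrite !inE => /injectiveP r_inj; apply/injectiveP => i j.
  by rewrite !ffunE => /r_inj.
apply: eq_bigr => h; rewrite inE => /injectiveP h_inj; rewrite sum1_card.
(* A point [w i] admits only the value [h i]; the condition is void off the image of [w]. *)
pose F x := [pred y | [forall i, (w i == x) ==> (y == h i)]].
transitivity #|family F|.
  apply: eq_card => r; rewrite [LHS]inE /= inE.
  apply/andP/familyP => [[_ /eqP rh] x | r_h].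
    by apply/forallP => i; apply/implyP => /eqP <-; rewrite -rh ffunE.
  have r_hE i : r (w i) = h i.
    by have /forallP/(_ i) := r_h (w i); rewrite eqxx => /eqP.
  split; last by apply/eqP/ffunP => i; rewrite ffunE r_hE.
  by apply/injectiveP => i j /=; rewrite !r_hE => /h_inj.
rewrite card_family foldrE big_map big_enum /=.
rewrite (bigID (mem (codom w))) /= big1 => [|x /codomP[i ->]].
  rewrite mul1n (eq_bigr (fun _ => #|B|)) => [|x x_w].
    rewrite prod_nat_const; congr (_ ^ _).
    by rewrite -(card_codom w_inj) -(cardC (mem (codom w))) addKn; apply: eq_card.
  apply: eq_card => y; rewrite !inE; apply/forallP => i; apply/implyP => /eqP wi.
  by rewrite -wi codom_f in x_w.
rewrite -(card1 (h i)); apply: eq_card => y; rewrite !inE.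
apply/forallP/idP => [/(_ i)|/eqP-> j]; first by rewrite eqxx.
by apply/implyP => /eqP/w_inj->.
Qed.

Lemma card_parking_inj_on n (I : finType) (w : I -> 'I_n) : injective w ->
  n.+1 * #|[set p : {ffun 'I_n -> 'I_n} | parking_function p & injectiveb (p \o w)]|
  = n.+1 ^_ #|I| * n.+1 ^ (n - #|I|).
Proof.
move=> w_inj; pose Q (r : {ffun 'I_n -> 'I_n.+1}) := injectiveb (r \o w).
have := card_ffun_inj_on 'I_n.+1 w_inj; rewrite !card_ord => <-.
transitivity (n.+1 * #|[set r | Q r && circle_parking r]|).
  congr (_ * _); pose up (p : {ffun 'I_n -> 'I_n}) := [ffun x => widen_ord (leqnSn n) (p x)].
  have up_inj : injective up.
    move=> p q /ffunP pq; apply/ffunP => x; have := pq x; rewrite !ffunE => /(congr1 val) /= ?.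
    exact: val_inj.
  have upQ p : Q (up p) && circle_parking (up p) = parking_function p && injectiveb (p \o w).
    rewrite parking_functionE andbC; congr (_ && _).
      by apply: eq_forallb => i; congr (_ < _); apply: eq_card => x; rewrite !inE ffunE.
    apply/injectiveP/injectiveP => h i j /= e; apply: h.
      by rewrite /= !ffunE e.
    by move: e; rewrite !ffunE => /(congr1 val) /= ?; apply: val_inj.
  rewrite -(card_imset _ up_inj); apply: eq_card => r; rewrite [RHS]inE.
  apply/imsetP/idP => [[p p_ok ->]|r_ok]; first by rewrite inE -upQ in p_ok.
  have /andP[_ /forallP r_park] := r_ok.
  have r_lt x : r x < n.
    have lt_n : n.-1 < n by have := ltn_ord x; lia.
    (* The last parking condition, at i = n - 1, puts all n values at or below n - 1, so the extra
       value n of the circle does not occur. *)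
    have all_le : [set y | r y <= n.-1] == setT.
      rewrite eqEcard subsetT cardsT card_ord /=.
      by have := r_park (Ordinal lt_n); rewrite /= (ltn_predK lt_n).
    by have := in_setT x; rewrite -(eqP all_le) inE; lia.
  have r_up : r = up [ffun x => Ordinal (r_lt x)].
    by apply/ffunP => x; rewrite !ffunE; apply: val_inj.
  by exists [ffun x => Ordinal (r_lt x)]; rewrite // inE -upQ -r_up.
(* Double count of the pairs (r, t) with [turn t r] parking: one t for each r, and by rotation
   invariance of [Q] equally many r for each t. *)
rewrite -[RHS]sum1_card (eq_bigr (fun r => \sum_t circle_parking (turn t r))); last first.
  by move=> r _; rewrite sum_circle_parking_turn.
rewrite exchange_big /= (eq_bigr (fun=> #|[set r | Q r && circle_parking r]|)).
  by rewrite sum_nat_const card_ord.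
move=> t _; rewrite card_set_sum [RHS](reindex (turn t)) /=; last first.
  by exists (turn (- t)%R) => r _; apply/ffunP => x; rewrite !ffunE opprK ?addrK ?subrK.
rewrite [LHS]big_mkcond; apply: eq_bigr => r _; rewrite inE.
have -> : Q (turn t r) = injectiveb (r \o w).
  apply/injectiveP/injectiveP => h i j /= e; apply: h; rewrite /= ?ffunE ?e //.
  by move: e; rewrite !ffunE => /addIr.
by case: injectiveb.
Qed.

(** * Moving the cycles to fixed positions *)

Lemma perm_extending (I T : finType) (w g : I -> T) : injective w -> injective g ->
  exists e : {perm T}, forall i, e (w i) = g i.
Proof.
(* An enumeration of T that begins with the image of [f] in the order of I; the permutation matches
   the entries of [s w] and [s g] at equal indices. *)
pose s (f : I -> T) := codom f ++ [seq x <- enum T | x \notin codom f].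
have s_all f x : x \in s f.
  by rewrite mem_cat mem_filter mem_enum andbT orbN.
have s_uniq f : injective f -> uniq (s f).
  move=> f_inj; rewrite cat_uniq filter_uniq ?enum_uniq // andbT.
  rewrite map_inj_uniq ?enum_uniq //=; apply/hasPn => x.
  by rewrite mem_filter => /andP[].
have s_size f : injective f -> size (s f) = #|T|.
  move=> f_inj; rewrite cardT; apply: perm_size.
  apply: uniq_perm; rewrite ?s_uniq ?enum_uniq //.
  by move=> x; rewrite s_all mem_enum.
move=> w_inj g_inj; pose e x := nth x (s g) (index x (s w)).
have e_lt x : index x (s w) < size (s g) by rewrite s_size // -(s_size w) // index_mem.
have e_inj : injective e.
  move=> x y; rewrite /e (set_nth_default y) // => /eqP.
  rewrite nth_uniq ?s_uniq // => /eqP /(congr1 (nth x (s w))).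
  by rewrite !nth_index.
exists (perm e_inj) => i; rewrite permE /e /s index_cat codom_f nth_cat.
rewrite index_map // size_codom.
have lt_i : index i (enum I) < #|I| by rewrite cardE index_mem mem_enum.
by rewrite lt_i (nth_map i) -?cardE // nth_index ?mem_enum.
Qed.

Lemma parking_function_perm n (p : {ffun 'I_n -> 'I_n}) (e : {perm 'I_n}) :
  parking_function [ffun x => p (e x)] = parking_function p.
Proof.
rewrite !parking_functionE; apply: eq_forallb => i; congr (_ < _).
rewrite -[RHS](card_preimset _ (@perm_inj _ e)).
by apply: eq_card => x; rewrite !inE ffunE.
Qed.

Lemma sum_parking_semiconj n (I : finType) (w : I -> 'I_n) (sg : I -> I) :
    injective w -> injective sg ->
  n.+1 * (\sum_(p : {ffun 'I_n -> 'I_n} | parking_function p)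
            #|[set g : {ffun I -> 'I_n} | injectiveb g
                                        & [forall i, p (g i) == g (sg i)]]|)
  = n.+1 ^_ #|I| * n.+1 ^ (n - #|I|).
Proof.
move=> w_inj sg_inj; rewrite -(card_parking_inj_on w_inj); congr (_ * _).
under eq_bigr do rewrite card_set_sum.
rewrite exchange_big /=.
transitivity (\sum_(g : {ffun I -> 'I_n}) \sum_(q : {ffun 'I_n -> 'I_n} | parking_function q)
   (injectiveb g && [forall i, q (w i) == g (sg i)])).
  apply: eq_bigr => g _.
  have [/injectiveP g_inj | _] := boolP (injectiveb g); last by rewrite !big1.
  have [e eE] := perm_extending w_inj g_inj.
  (* Since [e (w i) = g i], the condition on [p] at [g i] becomes one on [pull p] at [w i], and
     [pull] permutes the parking functions. *)
  pose pull (p : {ffun 'I_n -> 'I_n}) := [ffun x => p (e x)].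
  rewrite [RHS](reindex pull) /=; last first.
    exists (fun q : {ffun 'I_n -> 'I_n} => [ffun x => q ((e^-1)%g x)]) => q _;
      by apply/ffunP => x; rewrite !ffunE ?permK ?permKV.
  apply: eq_big => [p|p _]; first by rewrite parking_function_perm.
  by congr nat_of_bool; apply: eq_forallb => i; rewrite ffunE eE.
rewrite exchange_big /= -sum1dep_card [RHS]big_mkcondr /=; apply: eq_bigr => q _.
have [/injectiveP q_inj | q_ninj] := boolP (injectiveb (q \o w)).
  (* Solving q o w = g o sg for g leaves only q o w o sg^-1. *)
  pose g0 := [ffun i => q (w (invF sg_inj i))].
  have g0_ok : injectiveb g0 && [forall i, q (w i) == g0 (sg i)].
    apply/andP; split.
      by apply/injectiveP => i j; rewrite !ffunE => /q_inj; apply: (can_inj (f_invF sg_inj)).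
    by apply/forallP => i; rewrite ffunE invF_f.
  rewrite (bigD1 g0) //= g0_ok big1 // => g /eqP neq_g.
  apply/eqP; rewrite eqb0; apply/negP => /andP[_ /forallP gE]; apply: neq_g.
  by apply/ffunP => i; rewrite ffunE (eqP (gE _)) f_invF.
rewrite big1 // => g _; apply/eqP; rewrite eqb0; apply: contra q_ninj.
case/andP => /injectiveP g_inj /forallP gE.
by apply/injectiveP => i j /=; rewrite (eqP (gE i)) (eqP (gE j)) => /g_inj/sg_inj.
Qed.

(** * Cycles as tuples up to rotation *)

(** Choose distinct classes first, then one of the m representatives of each. It is used with [R]
    the map from a cycle tuple to its rotation class. *)
Lemma card_lift_inj (J U V : finType) (D : {set U}) (R : U -> V) m :
    (forall u, u \in D -> #|[set u' in D | R u' == R u]| = m) ->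
  #|[set T : {ffun J -> U} | [forall a, T a \in D] & injectiveb (R \o T)]|
  = #|R @: D| ^_ #|J| * m ^ #|J|.
Proof.
move=> fibre; rewrite -card_inj_ffuns_on -sum_nat_const -sum1_card.
pose image (T : {ffun J -> U}) := [ffun a => R (T a)].
pose H := [set h : {ffun J -> V} in ffun_on (mem (R @: D)) | injectiveb h].
rewrite (partition_big image (mem H)) /=; last first.
  move=> T; rewrite !inE => /andP[/forallP TD /injectiveP T_inj]; apply/andP; split.
    by apply/ffun_onP => a; rewrite ffunE imset_f.
  by apply/injectiveP => a b; rewrite !ffunE => /T_inj.
apply: eq_bigr => h; rewrite inE => /andP[/ffun_onP hD /injectiveP h_inj]; rewrite sum1_card.
pose F a := [pred u | (u \in D) && (R u == h a)].
transitivity #|family F|.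
  apply: eq_card => T; rewrite [LHS]inE /= inE.
  apply/andP/familyP => [[/andP[/forallP TD _] /eqP Th] a | TF].
    by rewrite inE /= TD -Th ffunE eqxx.
  have ThE a : R (T a) = h a by have /andP[_ /eqP] := TF a.
  split; last by apply/eqP/ffunP => a; rewrite ffunE.
  apply/andP; split; first by apply/forallP => a; have /andP[] := TF a.
  by apply/injectiveP => a b /=; rewrite !ThE => /h_inj.
rewrite card_family foldrE big_map big_enum /= -prod_nat_const.
apply: eq_bigr => a _; have /imsetP[u uD ->] := hD a.
by rewrite -(fibre u uD); apply: eq_card => u'; rewrite !inE.
Qed.

(** Puts [fcycle] into the intertwining form, with the cyclic successor [ordS] as the shift. *)
Lemma fcycle_tnth m (T : eqType) (p : T -> T) (t : m.-tuple T) :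
  fcycle p t = [forall b, p (tnth t b) == tnth t (ordS b)].
Proof.
case: m t => [|m] t; first by rewrite (tuple0 t) /=; apply/esym/forallP; case.
case/tupleP: t => x s.
have nth_succ i : i < m.+1 -> nth x (rcons s x) i = nth x (x :: s) (i.+1 %% m.+1).
  rewrite ltnS leq_eqVlt nth_rcons size_tuple => /predU1P[->|lt_im].
    by rewrite ltnn eqxx modnn.
  by rewrite lt_im modn_small.
apply/(pathP x)/forallP => /= h b; [|move=> lt_b].
  have lt_b : b < size (rcons s x) by rewrite size_rcons size_tuple.
  have := h b lt_b; rewrite !(tnth_nth x) /= nth_succ // -rcons_cons nth_rcons /=.
  by rewrite size_tuple ltn_ord.
have lt_bm : b < m.+1 by rewrite size_rcons size_tuple in lt_b.
have := h (Ordinal lt_bm); rewrite !(tnth_nth x) /= nth_succ // -rcons_cons nth_rcons /=.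
by rewrite size_tuple lt_bm.
Qed.

(** A cycle tuple is the orbit of its first entry under [p]. Two cycle tuples with the same entries
    are therefore the same orbit read from different starting points. *)
Lemma rotationsP {m n} {p : {ffun 'I_n -> 'I_n}} {t t' : m.-tuple 'I_n} :
    0 < m -> t \in cycle_tuples m p ->
  reflect (t' \in cycle_tuples m p /\ t' =i t) (t' \in rotations t).
Proof.
move=> m_gt0; rewrite inE => /andP[t_uniq t_cyc].
apply: (iffP imsetP) => [[i _ ->] | []]; rewrite inE.
  by rewrite /= rot_uniq rot_cycle t_uniq t_cyc; split=> // x; rewrite mem_rot.
move=> /andP[t'_uniq t'_cyc] t't.
have z_t' : tnth t' (Ordinal m_gt0) \in t' by exact: mem_tnth.
have z_t : tnth t' (Ordinal m_gt0) \in t by rewrite -t't.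
have lt_z : index (tnth t' (Ordinal m_gt0)) t < m.
  by rewrite -[X in _ < X](size_tuple t) index_mem.
exists (Ordinal lt_z) => //; apply: val_inj => /=.
rewrite -(orbitE t_cyc) // (orbitE t'_cyc) // (tnth_nth (tnth t' (Ordinal m_gt0))) /=.
by rewrite index_uniq ?rot0 // size_tuple.
Qed.

Lemma rotations_meet m n (p : {ffun 'I_n -> 'I_n}) (t t' : m.-tuple 'I_n) z :
    0 < m -> t \in cycle_tuples m p -> t' \in cycle_tuples m p ->
  z \in t -> z \in t' -> rotations t = rotations t'.
Proof.
move=> m_gt0 tC t'C zt zt'; have tt' : t =i t'.
  move: (tC) (t'C); rewrite !inE => /andP[tU tc] /andP[t'U t'c] x.
  by rewrite -(mem_rot (index z t)) -(orbitE tc) // (orbitE t'c) // mem_rot.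
apply/setP => s; apply/(rotationsP m_gt0 tC)/(rotationsP m_gt0 t'C) => -[sC st]; split=> // x.
  by rewrite st tt'.
by rewrite st tt'.
Qed.

Lemma card_rotations m n (t : m.-tuple 'I_n) : uniq t -> #|rotations t| = m.
Proof.
move=> t_uniq; rewrite card_imset ?card_ord // => i j /(congr1 val) /= rot_ij.
have x := tnth t i.
have nth_rot0 (k : 'I_m) : nth x (rot k t) 0 = nth x t k.
  by rewrite nth_cat size_drop size_tuple subn_gt0 ltn_ord nth_drop addn0.
apply: val_inj; apply/eqP.
by rewrite /= -(nth_uniq x _ _ t_uniq) ?size_tuple // -!nth_rot0 rot_ij.
Qed.

Lemma card_rotations_fibre m n (p : {ffun 'I_n -> 'I_n}) (t : m.-tuple 'I_n) :
    0 < m -> t \in cycle_tuples m p ->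
  #|[set t' in cycle_tuples m p | rotations t' == rotations t]| = m.
Proof.
move=> m_gt0 tC; have := tC; rewrite inE => /andP[t_uniq _].
rewrite -[RHS](@card_rotations _ _ t t_uniq); apply: eq_card => t'.
rewrite in_set; apply/andP/(rotationsP m_gt0 tC) => [[t'C /eqP e] | [t'C t't]].
  by apply/(rotationsP m_gt0 tC); rewrite -e; apply/(rotationsP m_gt0 t'C).
split=> //; have z := mem_tnth (Ordinal m_gt0) t'.
by apply/eqP; apply: (rotations_meet m_gt0 t'C tC z); rewrite -t't.
Qed.

(** Row [a] of [g] is a tuple [T a]. Distinct cycles are disjoint, so [g] is injective exactly when
    each row has distinct entries and the rows represent different cycles. *)
Lemma card_mcycle_arrays m n j (p : {ffun 'I_n -> 'I_n}) : 0 < m ->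
  #|[set g : {ffun 'I_j * 'I_m -> 'I_n} |
       injectiveb g & [forall ab, p (g ab) == g (ab.1, ordS ab.2)]]|
  = #|mcycles m p| ^_ j * m ^ j.
Proof.
move=> m_gt0.
have := card_lift_inj 'I_j (fun t => @card_rotations_fibre m n p t m_gt0).
rewrite card_ord /mcycles => <-.
pose flat (T : {ffun 'I_j -> m.-tuple 'I_n}) : {ffun 'I_j * 'I_m -> 'I_n} :=
  [ffun ab => tnth (T ab.1) ab.2].
have flat_bij : bijective flat.
  exists (fun g : {ffun 'I_j * 'I_m -> 'I_n} => [ffun a => [tuple g (a, b) | b < m]]).
    move=> T; apply/ffunP => a; rewrite ffunE.
    by apply: eq_from_tnth => b; rewrite tnth_mktuple ffunE.
  by move=> g; apply/ffunP => -[a b]; rewrite !ffunE tnth_mktuple.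
rewrite -(on_card_preimset (onW_bij _ flat_bij)); apply: eq_card => T; rewrite !inE.
have -> : [forall ab, p (flat T ab) == flat T (ab.1, ordS ab.2)] = [forall a, fcycle p (T a)].
  apply/forallP/forallP => [h a | h [a b]].
    by rewrite fcycle_tnth; apply/forallP => b; have := h (a, b); rewrite !ffunE.
  by have := h a; rewrite fcycle_tnth => /forallP/(_ b); rewrite !ffunE.
apply/andP/andP => [[/injectiveP g_inj /forallP T_cyc] | [/forallP TC /injectiveP T_inj]].
  have TC a : T a \in cycle_tuples m p.
    rewrite inE T_cyc andbT; apply/tuple_uniqP => b c e.
    by have := g_inj (a, b) (a, c); rewrite !ffunE /= => /(_ e) [].
  split; first exact/forallP.
  apply/injectiveP => a a' /= e; apply/eqP.
  (* Rows of the same class share their entries, so the first entry of row [a] recurs in row [a'],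
     and injectivity of [g] gives [a = a']. *)
  have /(rotationsP m_gt0 (TC a')) [_ mem_eq] : T a \in rotations (T a').
    by rewrite -e; apply/(rotationsP m_gt0 (TC a)).
  have := mem_tnth (Ordinal m_gt0) (T a); rewrite mem_eq => /tnthP[c ec].
  by have := g_inj (a, Ordinal m_gt0) (a', c); rewrite !ffunE /= => /(_ ec) [->].
split; last by apply/forallP => a; have := TC a; rewrite inE => /andP[].
apply/injectiveP => -[a b] [a' c]; rewrite !ffunE /= => e.
have ea : a = a'.
  apply: T_inj; apply: (@rotations_meet _ _ p _ _ (tnth (T a) b)) => //.
    exact: mem_tnth.
  by rewrite e mem_tnth.
rewrite -ea in e *; have := TC a; rewrite inE => /andP[/tuple_uniqP/(_ _ _ e)-> _] //.
Qed.

(** Taking j to be the number of cycles makes the count of arrays positive, and any such array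
    embeds ['I_j * 'I_m] into ['I_n]. *)
Lemma mcycles_leq m n (p : {ffun 'I_n -> 'I_n}) : 0 < m -> #|mcycles m p| * m <= n.
Proof.
move=> m_gt0; have := @card_mcycle_arrays m n #|mcycles m p| p m_gt0.
set G := [set g | _]; rewrite ffactnn => cardG.
have : 0 < #|G| by rewrite cardG muln_gt0 fact_gt0 expn_gt0 m_gt0.
case/card_gt0P => g; rewrite inE => /andP[/injectiveP g_inj _].
by have := leq_card g g_inj; rewrite card_prod !card_ord.
Qed.

(** * Factorial moments of the number of cycles *)

Lemma sum_parking_ffact m n j : 0 < m -> j * m <= n ->
  n.+1 * (\sum_(p : {ffun 'I_n -> 'I_n} | parking_function p)
            #|mcycles m p| ^_ j * m ^ j)
  = n.+1 ^_ (j * m) * n.+1 ^ (n - j * m).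
Proof.
move=> m_gt0 le_n; have card_I : #|{: 'I_j * 'I_m}| = j * m by rewrite card_prod !card_ord.
have le_In : #|{: 'I_j * 'I_m}| <= n by rewrite card_I.
(* The fixed positions are the first j * m indices. *)
pose w (ab : 'I_j * 'I_m) := widen_ord le_In (enum_rank ab).
have w_inj : injective w.
  by move=> x y /(congr1 val) /= e; apply: enum_rank_inj; apply: val_inj.
have sg_inj : injective (fun ab : 'I_j * 'I_m => (ab.1, ordS ab.2)).
  by move=> [a b] [a' c] e; have /= -> := congr1 fst e; have /= /ordS_inj -> := congr1 snd e.
have := sum_parking_semiconj w_inj sg_inj; rewrite card_I => <-.
by congr (_ * _); apply: eq_bigr => p _; rewrite -card_mcycle_arrays.
Qed.

(** * Inclusion-exclusion *)

Local Open Scope ring_scope.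

(** Both sides count the ordered pairs of disjoint subsets, of sizes k and l, of a set of size N. *)
Lemma mul_bin_addl N k l : ('C(k + l, k) * 'C(N, k + l) = 'C(N, k) * 'C(N - k, l))%N.
Proof.
have [le_N | lt_N] := leqP (k + l) N; last first.
  rewrite (bin_small lt_N) muln0; have [le_k|lt_k] := leqP k N; last by rewrite bin_small.
  by rewrite (@bin_small (N - k)) ?muln0 // ltn_subLR.
have le_k : (k <= N)%N by apply: leq_trans le_N; apply: leq_addr.
have le_l : (l <= N - k)%N by rewrite leq_subRL.
have f_gt0 : (0 < k`! * l`! * (N - (k + l))`!)%N by rewrite !muln_gt0 !fact_gt0.
have := bin_fact le_N; have := bin_fact le_k; have := bin_fact le_l.
have := bin_fact (leq_addr l k); rewrite addKn -subnDA => e1 e2 e3 e4.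
by apply/eqP; rewrite -(eqn_pmul2r f_gt0); apply/eqP; nia.
Qed.

(** Once 'C(N, k) is factored out, the sum is the expansion of (1 - 1)^(N - k). Terms with l > N - k
    vanish, so the range can depend on n alone; this lets the sum be exchanged with the one over
    parking functions. *)
Lemma bin_inversion (R : comNzRingType) N n k : (N <= n)%N ->
  \sum_(l < n.+1) (-1) ^+ l * ('C(k + l, k) * 'C(N, k + l))%:R
  = (N == k)%:R :> R.
Proof.
move=> le_Nn; under eq_bigr do rewrite mul_bin_addl natrM mulrCA.
rewrite -mulr_sumr.
have [lt_Nk | le_kN] := ltnP N k; first by rewrite bin_small // mul0r ltn_eqF.
have le_Nk : ((N - k).+1 <= n.+1)%N by rewrite ltnS (leq_trans (leq_subr _ _)).
transitivity ('C(N, k)%:R * (1 - 1) ^+ (N - k) : R).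
  pose f i : R := 1 ^+ (N - k - i) * (-1) ^+ i *+ 'C(N - k, i).
  congr (_ * _); rewrite exprDn (big_ord_widen _ f le_Nk) {}/f.
  rewrite [RHS]big_mkcond; apply: eq_bigr => l _ /=; rewrite expr1n mul1r mulr_natr.
  by case: ltnP => // lt_l; rewrite bin_small.
rewrite subrr expr0n subn_eq0 eqn_leq le_kN andbT.
have [le_N | lt_N] := leqP N k; last by rewrite mulr0.
by have -> : N = k; [apply/eqP; rewrite eqn_leq le_N | rewrite binn mulr1].
Qed.

Lemma sum_parking_bin n m j : (0 < m)%N -> (j * m <= n)%N ->
  \sum_(p : {ffun 'I_n -> 'I_n} | parking_function p) 'C(#|mcycles m p|, j)%:R
  = ((m.-1)`! ^ j)%:R / (j`!)%:R * multinom n m j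
    * n.+1%:R ^ (n%:Z - (j * m)%:Z - 1) :> rat.
Proof.
move=> m_gt0 le_n; have := sum_parking_ffact m_gt0 le_n.
under eq_bigr do rewrite -bin_ffact -mulnA.
rewrite -big_distrl /= => /(congr1 (fun x => x%:R : rat)).
have fac_eq : (n.+1 ^_ (j * m) * (n - j * m).+1`! = n.+1`!)%N.
  by rewrite -subSn // ffact_fact // leqW.
have fm : (m`! = m * (m.-1)`!)%N by rewrite -{1 2}(prednK m_gt0) factS.
have f_neq0 (i : nat) : i`!%:R != 0 :> rat by rewrite pnatr_eq0 -lt0n fact_gt0.
have H0 := f_neq0 (n - j * m).+1; have P0 := expf_neq0 j (f_neq0 m.-1).
have J0 := f_neq0 j; have M0 : m%:R ^+ j != 0 :> rat by rewrite expf_neq0 // pnatr_eq0 -lt0n.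
have N0 : n.+1%:R != 0 :> rat by rewrite pnatr_eq0.
rewrite !natrM natr_sum !natrX -/(j`!) => e.
rewrite /multinom -fac_eq fm expnMn [(_ ^_ _ * _`!)%:R]natrM.
rewrite [(_ * _ ^ _)%:R]natrM !natrX.
(* The exponent is -1 when j * m = n, hence the integer power. The inverse split off here cancels
   the factor n + 1 of [sum_parking_ffact]. *)
rewrite subzn // expfzDr // exprN1 -exprnP.
move: e; set S := \sum_(_ | _) _ => e.
move: e N0 J0 M0 H0 P0.
move: (n.+1%:R) (j`!%:R) (m%:R ^+ j) (_.+1`!%:R) (_.-1`!%:R ^+ j) => N J M H P.
move=> e N0 J0 M0 H0 P0; have -> : S = N * (S * (J * M)) / (N * (J * M)).
  by field; rewrite N0 J0 M0.
by rewrite e; field; rewrite N0 J0 M0 H0 P0.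
Qed.

Unset Implicit Arguments.

Theorem theorem2p3 (n m k : nat) (hn : (1 <= n)%N) (hm : (1 <= m)%N)
    (hkm : (k * m <= n)%N) :
  #|parking_with_mcycles n m k|%:R =
  \sum_(l < n.+1 | ((k + l) * m <= n)%N)
    (-1) ^+ l * (((m.-1)`! ^ (k + l))%:R / ((k`!)%:R * (l`!)%:R))
    * multinom n m (k + l)
    * n.+1%:R ^ (n%:Z - ((k + l) * m)%:Z - 1) :> rat.
Proof.
have -> : #|parking_with_mcycles n m k|%:R =
    \sum_(p : {ffun 'I_n -> 'I_n} | parking_function p) (#|mcycles m p| == k)%:R :> rat.
  rewrite -natr_sum; congr (_%:R); rewrite -sum1dep_card [LHS]big_mkcondr /=.
  by apply: eq_bigr => p _; case: eqP.
have N_le (p : {ffun 'I_n -> 'I_n}) : (#|mcycles m p| * m <= n)%N by exact: mcycles_leq.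
have N_le_n (p : {ffun 'I_n -> 'I_n}) : (#|mcycles m p| <= n)%N.
  by apply: leq_trans (N_le p); apply: leq_pmulr.
under eq_bigr do rewrite -(bin_inversion _ k (N_le_n _)).
rewrite exchange_big [RHS]big_mkcond /=; apply: eq_bigr => l _.
rewrite -mulr_sumr; case: ifP => [le_n | gt_n]; last first.
  (* When (k + l) * m > n, no function has k + l cycles of length m, so every binomial vanishes. *)
  rewrite big1 ?mulr0 // => p _; rewrite (@bin_small #|mcycles m p|) ?muln0 //.
  by rewrite -(ltn_pmul2r hm); apply: leq_ltn_trans (N_le p) _; rewrite ltnNge gt_n.
under eq_bigr do rewrite natrM.
rewrite -mulr_sumr sum_parking_bin // !mulrA; congr (_ * _ * _).
have f_neq0 (i : nat) : i`!%:R != 0 :> rat by rewrite pnatr_eq0 -lt0n fact_gt0.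
(* Writing (k + l)! as 'C(k + l, k) * k! * l! turns 'C(k + l, k) / (k + l)! into 1 / (k! * l!). *)
have := bin_fact (leq_addr l k); rewrite addKn => <-.
rewrite !natrM.
have : 'C(k + l, k)%:R != 0 :> rat by rewrite pnatr_eq0 -lt0n bin_gt0 leq_addr.
move=> ?; field; rewrite ?f_neq0 //.
Qed.
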